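(* In the setting below, if the restriction of $\eta$ to $\bar B_R$ is bounded, then $x$ is a Lebesgue point for $\eta$ with respect to $\mu$ if and only if $\mathbb{E}[|\eta(X^x_m)-\eta(x)|]\to0$ as $m\to\infty$.
   Context: Let $(\mathcal{X},d)$ be a metric space with Borel $\sigma$-algebra $\mathcal{B}$, $\eta:\mathcal{X}\to\mathbb{R}$ measurable, and $\mu:\mathcal{B}\to[0,\infty]$ a measure. Fix $x\in\mathcal{X}$ with $\mu(\bar B_r)>0$ for all $r>0$, where $\bar B_r=\{x':d(x,x')\le r\}$, and fix $R>0$ with $\mu(\bar B_R)<\infty$. The point $x$ is a Lebesgue point for $\eta$ with respect to $\mu$ if $\frac{1}{\mu(\bar B_r)}\int_{\bar B_r}|\eta(x')-\eta(x)|\,d\mu(x')\to0$ as $r\to0^+$. Let $\nu(A)=\mu(A\cap\bar B_R)/\mu(\bar B_R)$. Let $(\mathcal{Z}_m,\mathcal{G}_m,\nu_m)_{m\in\mathbb{N}}$ be arbitrary probability spaces, and on the product probability space $\Omega=\mathcal{X}\times\mathcal{X}^{\mathbb{N}}\times\prod_m\mathcal{Z}_m$ with product measure $\mathbb{P}=\nu\otimes\nu^{\otimes\mathbb{N}}\otimes\bigotimes_m\nu_m$ let $X,X_1,X_2,\dots$ and $\Theta_1,\Theta_2,\dots$ be the coordinate maps (so $X,X_1,\dots$ are i.i.d. with law $\nu$, independent of the $\Theta_m$'s). Let $\psi_m:[0,\infty)^m\times\mathcal{Z}_m\to\{1,\dots,m\}$ be measurable maps with $\psi_m(r_1,\dots,r_m,z)\in\arg\min_k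 r_k$ for all arguments, and set $X^x_m=X_{\psi_m(d(x,X_1),\dots,d(x,X_m),\Theta_m)}$. *)

(* Defs.v *)
From HB Require Import structures.
From mathcomp Require Import all_boot all_order all_algebra.
From mathcomp Require Import all_classical all_reals all_analysis.
Import Order.TTheory GRing.Theory Num.Theory.

Set Implicit Arguments.
Unset Strict Implicit.
Unset Printing Implicit Defensive.

Local Open Scope classical_set_scope.
Local Open Scope ring_scope.

Section defs.
Context {R : realType}.

Definition is_metric {T : Type} (dist : T -> T -> R) : Prop :=
  (forall x y, 0 <= dist x y) /\
  (forall x y, dist x y = 0 <-> x = y) /\
  (forall x y, dist x y = dist y x) /\
  (forall x y z, dist x z <= dist x y + dist y z).

Definition dist_open {T : Type} (dist : T -> T -> R) (U : set T) : Prop :=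
  forall y, U y -> exists2 e : R, 0 < e & [set z | dist y z < e] `<=` U.

Definition cball {T : Type} (dist : T -> T -> R) (x : T) (r : R) : set T :=
  [set y | dist x y <= r].

Definition lebesgue_point {d} {T : measurableType d} (dist : T -> T -> R)
    (mu : {measure set T -> \bar R}) (eta : T -> R) (x : T) : Prop :=
  ((fun r : R => (\int[mu]_(y in cball dist x r) (`|eta y - eta x|)%:E)
                   / mu (cball dist x r))%E
     @ 0^'+ --> (0 : \bar R)).

Definition rv_events {dO dS} {Omega : measurableType dO} {S : measurableType dS}
    (f : Omega -> S) : set (set Omega) :=
  [set f @^-1` A | A in measurable].

Definition mutually_independent {dO} {Omega : measurableType dO} {I : eqType}
    (P : probability Omega R) (F : I -> set (set Omega)) : Prop :=
  forall (J : seq I) (E : I -> set Omega), uniq J ->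
    (forall i, i \in J -> F i (E i)) ->
    P (\big[setI/setT]_(i <- J) E i) = (\prod_(i <- J) P (E i))%E.

End defs.

(* Main.v *)
(** Write f = |eta - eta x| (truncated, which does not matter almost surely),
    D_k = dist x X_k, and let nu be the common law of the X_k.

    If x is a Lebesgue point: X_k is independent of the other distances and of
    Theta, and once these are frozen, the set of values of X_k for which the
    index k is selected is a lower set for dist x, whatever the tie-breaking
    rule is.  Inside a small ball it is thus an increasing union of closed
    balls, so the average of f over it is at most e; summing over k, the
    expectation restricted to a small ball is at most e, and the nearest
    neighbour is outside of that ball with probability (1 - p)^m.

    Conversely, if exactly one X_k falls in the ball of radius r, it is the
    nearest neighbour, hence the expectation is at least
    m (1 - p)^(m - 1) int_(ball r) f dnu, where p = nu (ball r).  With m of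
    order 1 / (2 p) this dominates the average of f over the ball up to a factor 4.
    This m tends to infinity unless nu {x} > 0, in which case f x = 0 and
    continuity of nu from above suffice. *)

Require Import Defs.
From HB Require Import structures.
From mathcomp Require Import all_boot all_order all_algebra.
From mathcomp Require Import all_classical all_reals all_analysis.
From mathcomp Require Import measurable_realfun ring lra.
Import Order.TTheory GRing.Theory Num.Theory.

Local Open Scope classical_set_scope.
Local Open Scope ring_scope.

(** * Nonnegative limits, independence and Fubini *)

Lemma cvge0P {R : realType} {I : Type} (F : set_system I) {FF : Filter F}
    (u : I -> \bar R) : (forall i, (0 <= u i)%E) ->
  u @ F --> (0 : \bar R) <->
  (forall e : R, 0 < e -> \forall i \near F, (u i <= e%:E)%E).
Proof.
move=> u0; split=> [u_0 e e0|ue].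
  have /fine_cvgP[fu /cvgr0Pnorm_le/(_ _ e0) ule] := u_0.
  near=> i; have fi : u i \is a fin_num by near: i.
  rewrite -(fineK fi) lee_fin (le_trans (ler_norm _))//.
  by near: i.
apply/fine_cvgP; split.
  near=> i; rewrite ge0_fin_numE// (@le_lt_trans _ _ 1%:E) ?ltry//.
  by near: i; exact: ue.
apply/cvgr0Pnorm_le => e e0; near=> i.
have uie : (u i <= e%:E)%E by near: i; exact: ue.
rewrite /= ger0_norm ?fine_ge0// -lee_fin fineK// ge0_fin_numE//.
by rewrite (le_lt_trans uie)// ltry.
Unshelve. all: by end_near. Qed.

(** Dynkin's theorem: finite intersections of events from the families in [J] form a pi-system [G],
    and the events independent of [A] form a lambda-system [H]. *)
Lemma mutually_independent_sigma {R : realType} {d} {Omega : measurableType d}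
    {I : eqType} (P : probability Omega R) (F : I -> set (set Omega))
    (i0 : I) (J : seq I) (A B : set Omega) :
  mutually_independent P F ->
  (forall i, F i `<=` measurable) -> (forall i, F i setT) ->
  (forall i, setI_closed (F i)) ->
  uniq (i0 :: J) -> F i0 A ->
  <<s [set C | exists2 i, i \in J & F i C] >> B ->
  P (A `&` B) = (P A * P B)%E.
Proof.
move=> indF mF FT FI /[dup] uJ' /= /andP[i0J uJ] FA.
pose G := [set C | exists2 E : I -> set Omega, (forall i, F i (E i)) &
                     C = \big[setI/setT]_(i <- J) E i].
have mA : measurable A by exact: mF FA.
have GI : setI_closed G.
  move=> _ _ [E FE ->] [E' FE' ->]; exists (fun i => E i `&` E' i).
    by move=> i; exact: FI.
  by rewrite big_split.
pose H := [set C | measurable C /\ P (A `&` C) = (P A * P C)%E].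
have lH : lambda_system setT H.
  apply/dynkin_lambda_system; split.
  - by split=> //; rewrite setIT probability_setT mule1.
  - move=> C [mC PC]; split; first exact: measurableC.
    rewrite probability_setC// muleBr ?fin_num_measure// mule1 -PC.
    by rewrite -setDE measureD// (le_lt_trans (probability_le1 P mA)) ?ltry.
  - move=> C tC HC; split; first by apply: bigcup_measurable => n _; have [] := HC n.
    rewrite setI_bigcupr !measure_bigcup//; last 3 first.
    + by move=> n _; have [] := HC n.
    + by move=> n _; have [mC _] := HC n; exact: measurableI.
    + exact: trivIset_setIl.
    rewrite -(fineK (fin_num_measure P A mA)) -nneseriesZl//.
    by apply: eq_eseriesr => n _; rewrite fineK ?fin_num_measure//; have [] := HC n.
have GH : G `<=` H.
  move=> _ [E FE ->]; split.
    by apply: bigsetI_measurable => i _; exact: mF (FE i).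
  (* With [A] placed at index [i0], independence over [i0 :: J] and then over [J] yields the product
     formula. *)
  pose E' i := if i == i0 then A else E i.
  have EE' : \big[setI/setT]_(i <- J) E i = \big[setI/setT]_(i <- J) E' i.
    apply: eq_big_seq => i iJ; rewrite /E' ifN//.
    by apply: contraNneq i0J => <-.
  have FE' i : F i (E' i) by rewrite /E'; case: eqP => [->|].
  rewrite EE'; have := indF _ _ uJ' (fun i _ => FE' i).
  rewrite !big_cons /E' eqxx -/E' => ->.
  by rewrite indF.
move=> sB.
suff : H B by case.
apply: (lambda_system_subset GI lH GH) => //.
apply: sub_smallest2r sB => // C [i iJ FC].
(* A generator lies in [G] once all other factors are set to [setT]. *)
exists (fun j => if j == i then C else setT).
  by move=> j; case: eqP => [->|_].
rewrite (big_rem i iJ)/= eqxx big_seq big1 ?setIT//.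
move=> j; rewrite mem_rem_uniq// inE => /andP[/negPf -> //].
Qed.

(** The joint law of [Y] and [W] agrees on rectangles with the product of [nu] and the law of [W],
    so the two coincide and Tonelli applies. *)
Lemma integral_indep_pair {R : realType} {d dT dS} {Omega : measurableType d}
    {T : measurableType dT} {S : measurableType dS}
    (P : probability Omega R) (nu : probability T R) (Y : Omega -> T)
    (W : Omega -> S) (g : T * S -> \bar R) :
  measurable_fun setT Y -> measurable_fun setT W ->
  (forall A, measurable A -> P (Y @^-1` A) = nu A) ->
  (forall A B, measurable A -> measurable B ->
    P (Y @^-1` A `&` W @^-1` B) = (P (Y @^-1` A) * P (W @^-1` B))%E) ->
  measurable_fun setT g -> (forall z, (0 <= g z)%E) ->
  (\int[P]_w g (Y w, W w) = \int[P]_w \int[nu]_y g (y, W w))%E.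
Proof.
move=> mY mW lawY YW mg g0.
pose W' : {mfun Omega >-> S} := HB.pack W (isMeasurableFun.Build _ _ _ _ _ mW).
pose YW' : {mfun Omega >-> (T * S)%type} := HB.pack (fun w => (Y w, W w))
  (isMeasurableFun.Build _ _ _ _ _ (measurable_fun_pair mY mW)).
transitivity (\int[distribution P YW']_z g z)%E.
  by rewrite ge0_integral_distribution.
transitivity (\int[nu \x distribution P W']_z g z)%E.
  apply: eq_measure_integral => C mC _; apply/esym.
  apply: product_measure_unique => // A B mA mB.
  by rewrite [in RHS]/= -(lawY A mA) -YW.
rewrite fubini_tonelli2// ge0_integral_distribution//.
- exact: measurable_fun_fubini_tonelli_G.
- by move=> z; exact: integral_ge0.
Qed.

Lemma integral_section_indic {R : realType} {dT dS : measure_display}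
    {T : measurableType dT} {S : measurableType dS}
    (mu : {measure set T -> \bar R}) (f : T -> R) (C : set (T * S)) (s : S) :
  (\int[mu]_(y in [set y | C (y, s)]) (f y)%:E =
   \int[mu]_y ((f y)%:E * (\1_C (y, s))%:E))%E.
Proof.
rewrite integral_mkcond epatch_indic; apply: eq_integral => y _.
by rewrite !indicE; congr (_ * (_ %:R)%:E)%E; apply/idP/idP; rewrite !inE.
Qed.

Lemma measurable_set_section {dT dS : measure_display}
    {T : measurableType dT} {S : measurableType dS} (C : set (T * S)) (s : S) :
  measurable C -> measurable [set y | C (y, s)].
Proof.
have ms : measurable_fun setT (fun y : T => (y, s)) by exact: measurable_fun_pair.
by move=> mC; rewrite -[X in measurable X]setTI; exact: ms.
Qed.

Lemma measurable_integral_section {R : realType} {dT dS : measure_display}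
    {T : measurableType dT} {S : measurableType dS} (nu : probability T R)
    (f : T -> R) (C : set (T * S)) :
  measurable_fun setT f -> (forall y, 0 <= f y) -> measurable C ->
  measurable_fun setT
    (fun s => \int[nu]_(y in [set y | C (y, s)]) (f y)%:E)%E.
Proof.
move=> mf f0 mC; under eq_fun do rewrite integral_section_indic.
apply: (measurable_fun_fubini_tonelli_G (fun z => (f z.1)%:E * (\1_C z)%:E)%E).
  apply: emeasurable_funM; last exact/measurable_EFinP.
  by apply/measurable_EFinP; exact: measurableT_comp.
by move=> z; rewrite mule_ge0 ?lee_fin.
Qed.

Section independent_pair.
Context {R : realType} {d dT dS : measure_display} {Omega : measurableType d}
  {T : measurableType dT} {S : measurableType dS}.
Variables (P : probability Omega R) (nu : probability T R).
Variables (Y : Omega -> T) (W : Omega -> S).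
Hypothesis mY : measurable_fun setT Y.
Hypothesis mW : measurable_fun setT W.
Hypothesis lawY : forall A, measurable A -> P (Y @^-1` A) = nu A.
Hypothesis indepYW : forall A B, measurable A -> measurable B ->
  P (Y @^-1` A `&` W @^-1` B) = (P (Y @^-1` A) * P (W @^-1` B))%E.

Lemma integral_indep_section (f : T -> R) (C : set (T * S)) :
  measurable_fun setT f -> (forall y, 0 <= f y) -> measurable C ->
  (\int[P]_(w in [set w | C (Y w, W w)]) (f (Y w))%:E =
   \int[P]_w \int[nu]_(y in [set y | C (y, W w)]) (f y)%:E)%E.
Proof.
move=> mf f0 mC.
pose g (z : T * S) := ((f z.1)%:E * (\1_C z)%:E)%E.
transitivity (\int[P]_w g (Y w, W w))%E.
  rewrite integral_mkcond epatch_indic; apply: eq_integral => w _.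
  by rewrite /g/= !indicE; congr (_ * (_ %:R)%:E)%E; apply/idP/idP; rewrite !inE.
rewrite (integral_indep_pair _ nu)//.
- by apply: eq_integral => w _; rewrite integral_section_indic.
- apply: emeasurable_funM; last exact/measurable_EFinP.
  by apply/measurable_EFinP; exact: measurableT_comp.
- by move=> z; rewrite mule_ge0 ?lee_fin.
Qed.

Lemma probability_indep_section (C : set (T * S)) : measurable C ->
  P [set w | C (Y w, W w)] = (\int[P]_w nu [set y | C (y, W w)])%E.
Proof.
move=> mC; transitivity (\int[P]_(w in [set w | C (Y w, W w)]) (cst 1 (Y w))%:E)%E.
  rewrite -[LHS]mul1e -integral_cst//.
  by rewrite -[X in measurable X]setTI; apply: (measurable_fun_pair mY mW).
rewrite (integral_indep_section (cst 1))//; apply: eq_integral => w _.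
rewrite -[RHS]mul1e -integral_cst//.
exact: measurable_set_section.
Qed.

(** Replaces conditioning on [W]: the bound holds with [W] frozen at each value [s] and is then
    integrated. *)
Lemma integral_indep_section_le (f : T -> R) (e : R) (C : set (T * S)) :
  measurable_fun setT f -> (forall y, 0 <= f y) -> measurable C -> 0 <= e ->
  (forall s, \int[nu]_(y in [set y | C (y, s)]) (f y)%:E <=
             e%:E * nu [set y | C (y, s)])%E ->
  (\int[P]_(w in [set w | C (Y w, W w)]) (f (Y w))%:E <=
   e%:E * P [set w | C (Y w, W w)])%E.
Proof.
move=> mf f0 mC e0 fe.
have msec s : measurable [set y | C (y, s)] by exact: measurable_set_section.
have mnu : measurable_fun setT (fun w => nu [set y | C (y, W w)]).
  rewrite [X in measurable_fun _ X](_ : _ =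
    (fun s => \int[nu]_(y in [set y | C (y, s)]) (cst 1 y)%:E)%E \o W).
    by apply: measurableT_comp => //; exact: measurable_integral_section.
  by apply/funext => w; rewrite /= -[LHS]mul1e -integral_cst.
rewrite integral_indep_section// probability_indep_section//.
rewrite -ge0_integralZl ?lee_fin//.
apply: ge0_le_integral => //.
- by move=> w _; apply: integral_ge0 => y _; rewrite lee_fin.
- pose F s := (\int[nu]_(y in [set y | C (y, s)]) (f y)%:E)%E.
  apply: (@measurableT_comp _ _ _ _ _ _ F) => //.
  exact: measurable_integral_section.
- exact: measurable_funeM.
Qed.

Lemma integral_indep_setX (f : T -> R) (A : set T) (B : set S) :
  measurable_fun setT f -> (forall y, 0 <= f y) ->
  measurable A -> measurable B ->
  (\int[P]_(w in Y @^-1` A `&` W @^-1` B) (f (Y w))%:E =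
   \int[nu]_(y in A) (f y)%:E * P (W @^-1` B))%E.
Proof.
move=> mf f0 mA mB.
have mWB : measurable (W @^-1` B) by rewrite -[X in measurable X]setTI; exact: mW.
rewrite (integral_indep_section f (A `*` B))//; last exact: measurableX.
rewrite (_ : \int[P]_w _ = \int[P]_w
  ((\int[nu]_(y in A) (f y)%:E) * (\1_(W @^-1` B) w)%:E))%E.
  rewrite ge0_integralZl ?integral_indic ?setIT//.
  - exact/measurable_EFinP.
  - by apply: integral_ge0 => y _; rewrite lee_fin.
apply: eq_integral => w _; rewrite indicE.
have [/set_mem WB|/negP WB] := boolP (w \in W @^-1` B).
  by rewrite mule1; congr (integral _ _ _); apply/seteqP; split=> y //= -[].
rewrite mule0 (_ : [set y | _] = set0) ?integral_set0//.
by apply/seteqP; split=> y //= -[_ Bw]; apply: WB; rewrite inE.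
Qed.

End independent_pair.

(** * Averages over lower sets *)

(** A nonempty [A] is a closed ball if [del] attains its supremum on it; otherwise it is an
    increasing union of closed balls, and monotone convergence applies. *)
Lemma integral_lowerset_le {R : realType} {dT} {T : measurableType dT}
    (nu : probability T R) (del f : T -> R) (r0 e : R) (A : set T) :
  measurable_fun setT del -> (forall y, 0 <= del y) ->
  measurable_fun setT f -> (forall y, 0 <= f y) ->
  (forall y, del y = 0 -> f y = 0) -> 0 <= e ->
  (forall r : R, 0 < r -> r <= r0 ->
    (\int[nu]_(y in [set y | (del y <= r)%R]) (f y)%:E <=
     e%:E * nu [set y | (del y <= r)%R])%E) ->
  (forall y, A y -> del y <= r0) ->
  (forall y y', A y -> del y' <= del y -> A y') ->
  (\int[nu]_(y in A) (f y)%:E <= e%:E * nu A)%E.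
Proof.
move=> mdel del0 mf f0 f0E e0 fe Ar0 lowA.
have mball r : measurable [set y | (del y <= r)%R].
  by rewrite -[X in measurable X]setTI; exact: measurable_fun_le.
(* For [r <= 0] the ball lies in the zero set of [del], where [f] vanishes; the radii used below may
   thus be nonpositive. *)
have {}fe r : r <= r0 -> (\int[nu]_(y in [set y | (del y <= r)%R]) (f y)%:E <=
    e%:E * nu [set y | (del y <= r)%R])%E.
  have [r_gt0|r_le0 _] := ltP 0 r; first exact: fe.
  rewrite integral0_eq ?mule_ge0// => y /= dy; rewrite f0E//.
  by apply/eqP; rewrite eq_le del0 (le_trans dy).
have [->|/set0P[a Aa]] := eqVneq A set0; first by rewrite integral_set0 measure0 mule0.
pose D := del @` A.
have supD : has_sup D.
  by split; [exists (del a), a|exists r0 => _ [y Ay <-]; exact: Ar0].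
have [[b Ab bsup]|nmax] := pselect (exists2 b, A b & del b = sup D).
  suff -> : A = [set y | del y <= del b] by apply: fe; exact: Ar0.
  apply/seteqP; split=> y /=; last exact: lowA.
  by move=> Ay; rewrite bsup; apply: ub_le_sup; [exact: supD.2|exists y].
have ltD y : A y -> del y < sup D.
  move=> Ay; rewrite lt_neqAle ub_le_sup ?andbT; [|exact: supD.2|by exists y].
  by apply/eqP => dy; apply: nmax; exists y.
(* Each radius is strictly below the supremum, so some point of [A] lies farther and [F n] is
   contained in [A]. *)
pose F n := [set y | del y <= sup D - n.+1%:R^-1].
have FA n : F n `<=` A.
  move=> y /= Fy.
  have n0 : 0 < (n.+1%:R^-1 : R) by rewrite invr_gt0.
  have [_ [c Ac <-] dc] := sup_adherent n0 supD.
  by apply: (lowA c) => //; rewrite (le_trans Fy)// ltW.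
have AF : A = \bigcup_n F n.
  apply/seteqP; split=> [y Ay|y [n _ /FA]//].
  have dy : 0 < sup D - del y by rewrite subr_gt0 ltD.
  have [n _ /(_ n (leqnn _)) /= nd] := near_infty_natSinv_lt (PosNum dy).
  exists n => //; rewrite /F/= lerBrDr addrC -lerBrDr.
  exact: (ltW nd).
have supr0 : sup D <= r0.
  by apply: ge_sup => [|_ [y Ay <-]]; [exact: supD.1|exact: Ar0].
have ndF : nondecreasing_seq F.
  move=> n p np; apply/subsetPset => y /= Fy.
  rewrite /F/= (le_trans Fy)// lerD2l lerN2 lef_pV2 ?posrE//.
  by rewrite ler_nat.
have mfF n : measurable_fun (F n) (EFin \o f).
  by apply: (measurable_funS measurableT) => //; exact/measurable_EFinP.
have Fcvg : (\int[nu]_(y in F n) (f y)%:E)%E @[n --> \oo] -->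
    (\int[nu]_(y in A) (f y)%:E)%E.
  rewrite AF; apply: (@ge0_nondecreasing_set_cvg_integral _ _ _ F (EFin \o f)) => //.
  - by move=> n; exact: mball.
  - by move=> n y _; rewrite lee_fin.
rewrite -(cvg_lim _ Fcvg)//; apply: lime_le; first by apply/cvg_ex; eexists; exact: Fcvg.
apply: nearW => n; apply: (@le_trans _ _ (e%:E * nu (F n))%E).
  by apply: fe; rewrite (le_trans _ supr0)// gerBl invr_ge0.
rewrite lee_wpmul2l ?lee_fin// le_measure ?inE//; first exact: mball.
by rewrite AF; apply: bigcup_measurable => k _; exact: mball.
Qed.

Lemma measurable_fun_mktuple {d d'} {S : measurableType d}
    {T : measurableType d'} n (F : 'I_n -> S -> T) :
  (forall i, measurable_fun setT (F i)) ->
  measurable_fun setT (fun s => [tuple F i s | i < n]).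
Proof.
move=> mF; apply/measurable_fun_tnthP => i.
by rewrite (_ : _ \o _ = F i)//; apply/funext => s /=; rewrite tnth_mktuple.
Qed.

(** * Nearest neighbour: the selection event and two bounds on the expectation *)

Section nearest_neighbour.
Context {R : realType} {dT dO dZ : measure_display} {T : measurableType dT}
  {Omega : measurableType dO} {Z : measurableType dZ}.
Variables (P : probability Omega R) (nu : probability T R) (m : nat).
Variables (X : 'I_m.+1 -> Omega -> T) (Th : Omega -> Z).
Variable psi : (m.+1.-tuple R * Z)%type -> 'I_m.+1.
Variables (del f : T -> R).
Hypothesis mX : forall i, measurable_fun setT (X i).
Hypothesis mTh : measurable_fun setT Th.
Hypothesis lawX : forall i A, measurable A -> P (X i @^-1` A) = nu A.
Hypothesis indepXTh : mutually_independent P (fun i : option 'I_m.+1 =>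
  if i is Some i then rv_events (X i) else rv_events Th).
Hypothesis mpsi : forall k : 'I_m.+1,
  measurable ([set p : (m.+1.-tuple R * Z)%type | forall i, 0 <= tnth p.1 i]
              `&` (psi @^-1` [set k])).
Hypothesis psi_min : forall (t : m.+1.-tuple R) (z : Z),
  (forall i, 0 <= tnth t i) -> forall k, tnth t (psi (t, z)) <= tnth t k.
Hypothesis mdel : measurable_fun setT del.
Hypothesis del0 : forall y, 0 <= del y.
Hypothesis mf : measurable_fun setT f.
Hypothesis f0 : forall y, 0 <= f y.

Definition nn_index (w : Omega) : 'I_m.+1 :=
  psi ([tuple del (X k w) | k < m.+1], Th w).

(* The k-th entry is a dummy, so that this does not depend on X k. *)
Definition other_dists (k : 'I_m.+1) (w : Omega) : (m.+1.-tuple R * Z)%type :=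
  ([tuple if i == k then 0 else del (X i w) | i < m.+1], Th w).

Definition insert_dist (k : 'I_m.+1) (p : T * (m.+1.-tuple R * Z)) :
    (m.+1.-tuple R * Z)%type :=
  ([tuple if i == k then del p.1 else tnth p.2.1 i | i < m.+1], p.2.2).

(* Nonnegativity is included since psi is only assumed measurable there. *)
Definition selection (k : 'I_m.+1) : set (T * (m.+1.-tuple R * Z)) :=
  insert_dist k @^-1` ([set p : (m.+1.-tuple R * Z)%type | forall i, 0 <= tnth p.1 i]
              `&` (psi @^-1` [set k])).

Lemma measurable_other_dists k : measurable_fun setT (other_dists k).
Proof.
apply: measurable_fun_pair => //; apply: measurable_fun_mktuple => i.
by case: eqP => // _; exact: measurableT_comp.
Qed.

Lemma measurable_insert_dist k : measurable_fun setT (insert_dist k).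
Proof.
apply: measurable_fun_pair; last exact: measurableT_comp.
apply: (measurable_fun_mktuple _
  (fun i (p : T * (m.+1.-tuple R * Z)) => if i == k then del p.1 else tnth p.2.1 i)) => i.
case: eqP => _; first exact: measurableT_comp.
apply: (@measurableT_comp _ _ _ _ _ _ (fun t : m.+1.-tuple R => tnth t i)).
  exact: measurable_tnth.
exact: measurableT_comp.
Qed.

Lemma measurable_selection k : measurable (selection k).
Proof.
by rewrite -[X in measurable X]setTI; exact: measurable_insert_dist.
Qed.

Lemma insert_other_dists k w :
  insert_dist k (X k w, other_dists k w) = ([tuple del (X i w) | i < m.+1], Th w).
Proof.
rewrite /insert_dist; congr (_, _); apply: eq_from_tnth => i; rewrite !tnth_mktuple/=.
by case: eqP => [->|].
Qed.

Lemma selectionE k w : selection k (X k w, other_dists k w) <-> nn_index w = k.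
Proof.
rewrite /selection/= insert_other_dists; split=> [[]//|nnk]; split=> // i.
by rewrite tnth_mktuple; case: eqP => // /eqP ik; rewrite tnth_mktuple (negPf ik).
Qed.

(** At equal distances the tuples coincide, so [psi] gives the same answer. If [y'] is strictly
    closer and some [j] other than [k] were selected, minimality of [k] before and of [j] after
    would give [del y <= del y']. *)
Lemma selection_lower k s y y' :
  selection k (y, s) -> del y' <= del y -> selection k (y', s).
Proof.
move=> [t0 psik] y'y.
have {}psik : psi (insert_dist k (y, s)) = k by [].
have t'0 i : 0 <= tnth (insert_dist k (y', s)).1 i.
  by have := t0 i; rewrite !tnth_mktuple; case: eqP.
split=> //; change (psi (insert_dist k (y', s)) = k).
have [y'lty|yy'] := ltP (del y') (del y); last first.
  have dd : del y' = del y by apply/eqP; rewrite eq_le y'y.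
  by rewrite -[RHS]psik /insert_dist/= dd.
apply/eqP; apply: contraT => jk.
have := psi_min _ s.2 t'0 k; have := psi_min _ s.2 t0 (psi (insert_dist k (y', s))).
rewrite [psi (_, _)]psik !tnth_mktuple eqxx (negPf jk) => a b.
by have := lt_le_trans y'lty (le_trans a b); rewrite ltxx.
Qed.

(** As its [k]-th entry is constant, [other_dists k] is measurable for the sigma-algebra generated
    by [Th] and the samples other than [X k]. *)
Lemma indep_other_dists k A B : measurable A -> measurable B ->
  P (X k @^-1` A `&` other_dists k @^-1` B) =
  (P (X k @^-1` A) * P (other_dists k @^-1` B))%E.
Proof.
move=> mA mB.
pose F (i : option 'I_m.+1) := if i is Some i then rv_events (X i) else rv_events Th.
pose J : seq (option 'I_m.+1) := None :: [seq Some i | i <- rem k (enum 'I_m.+1)].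
have uJ : uniq (Some k :: J).
  rewrite /= map_inj_uniq; last by move=> ? ? [].
  rewrite rem_uniq ?enum_uniq// andbT inE/= mem_map; last by move=> ? ? [].
  rewrite mem_rem_uniq ?enum_uniq// inE eqxx/=.
  by apply/mapP => -[].
apply: (@mutually_independent_sigma _ _ _ _ P F (Some k) J) => //.
- move=> [i|] _ [C mC <-]; rewrite -[X in measurable X]setTI.
    exact: mX.
  exact: mTh.
- by move=> [i|]; exists setT.
- by move=> [i|] _ _ [C mC <-] [D mD <-]; (exists (C `&` D); first exact: measurableI).
- by exists A.
set G := [set C | _].
have mo : @measurable_fun _ _ (g_sigma_algebraType G) _ setT (other_dists k).
  apply: measurable_fun_pair; last first.
    move=> _ C mC; rewrite setTI; apply: sub_sigma_algebra.
    by exists None => //; exists C.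
  apply: (@measurable_fun_mktuple _ _ (g_sigma_algebraType G)) => i.
  case: eqP => [_|/eqP ik]; first exact: measurable_cst.
  move=> _ C mC; rewrite setTI; apply: sub_sigma_algebra.
  exists (Some i).
    rewrite inE/= mem_map; last by move=> ? ? [].
    by rewrite mem_rem_uniq ?enum_uniq// !inE ik mem_enum.
  exists (del @^-1` C) => //.
  by rewrite -[X in measurable X]setTI; exact: mdel.
have : @measurable _ (g_sigma_algebraType G) (other_dists k @^-1` B).
  by rewrite -[X in measurable X]setTI; exact: mo.
by [].
Qed.

Lemma measurable_sublevel r : measurable [set y | del y <= r].
Proof. by rewrite -[X in measurable X]setTI; exact: measurable_fun_le. Qed.

Lemma measurable_nn_index k : measurable [set w | nn_index w = k].
Proof.
rewrite (_ : [set w | _] = (fun w => (X k w, other_dists k w)) @^-1` selection k).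
  rewrite -[X in measurable X]setTI.
  apply: (measurable_fun_pair (mX k) (measurable_other_dists k)) => //.
  exact: measurable_selection.
by apply/seteqP; split=> w /selectionE.
Qed.

(** The random index takes finitely many values, so the function is a sum over the events on which
    the index is constant. *)
Lemma measurable_nn : measurable_fun setT (fun w => (f (X (nn_index w) w))%:E).
Proof.
rewrite [X in measurable_fun _ X](_ : _ = fun w =>
  (\sum_(k < m.+1) (f (X k w))%:E * (\1_[set w | nn_index w = k] w)%:E)%E).
  apply: emeasurable_fun_sum => k; apply: emeasurable_funM.
    by apply/measurable_EFinP; exact: measurableT_comp.
  by apply/measurable_EFinP; apply: measurable_indic; exact: measurable_nn_index.
apply/funext => w; rewrite (bigD1 (nn_index w))//= indicE mem_set// mule1.
rewrite big1 ?adde0// => k kN; rewrite indicE memNset ?mule0//=.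
by move=> Nk; rewrite Nk eqxx in kN.
Qed.

(** When some sample is within [r0], the event is split by the selected index and the other data are
    frozen; when all are farther, [f] is bounded by [K]. *)
Lemma nn_integral_le (r0 e K : R) : 0 <= e -> (forall y, f y <= K) ->
  (forall y, del y = 0 -> f y = 0) ->
  (forall r : R, 0 < r -> r <= r0 ->
    (\int[nu]_(y in [set y | (del y <= r)%R]) (f y)%:E <=
     e%:E * nu [set y | (del y <= r)%R])%E) ->
  (\int[P]_w (f (X (nn_index w) w))%:E <=
   e%:E + K%:E * P (\bigcap_i [set w | (r0 < del (X i w))%R]))%E.
Proof.
move=> e0 fK f0E fe.
pose A k := [set w | nn_index w = k /\ del (X k w) <= r0].
pose far := \bigcap_i [set w | (r0 < del (X i w))%R].
have mXle k : measurable [set w | del (X k w) <= r0].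
  rewrite -[X in measurable X]setTI.
  exact: (mX k measurableT [set y | del y <= r0] (measurable_sublevel r0)).
have mA k : measurable (A k).
  exact: (measurableI _ _ (measurable_nn_index k) (mXle k)).
have mfar : measurable far.
  apply: fin_bigcap_measurable => // i _.
  rewrite (_ : [set w | _] = ~` [set w | del (X i w) <= r0]).
    exact: measurableC.
  by apply/seteqP; split=> w /=; rewrite ltNge => /negP.
(* If some sample is within [r0], so is the nearest one. *)
have AE : \big[setU/set0]_(k < m.+1) A k = ~` far.
  rewrite -bigcup_mkord_ord; apply/seteqP; split=> [w [k _ [_ Xk]] /(_ _ I)|w nfar].
    by move=> /(_ (inord k)) /=; rewrite ltNge Xk.
  exists (nn_index w) => //=; rewrite inord_val; split=> //.
  have [i] : exists i, del (X i w) <= r0.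
    apply: contrapT => /forallNP ri; apply: nfar => i _ /=.
    by rewrite ltNge; apply/negP.
  apply: le_trans.
  have := psi_min [tuple del (X k w) | k < m.+1] (Th w).
  rewrite -/(nn_index w) => /(_ _ i); rewrite !tnth_mktuple; apply => j.
  by rewrite tnth_mktuple.
have tA : trivIset setT A.
  by move=> i j _ _ [w [[<- _] [<- _]]].
rewrite -(setvU far) ge0_integral_setU//; last 4 first.
- exact: measurableC.
- by rewrite setvU; exact: measurable_nn.
- by move=> w _; rewrite lee_fin.
- by rewrite disj_set2E setICl.
apply: leeD; last first.
  rewrite -integral_cst//; apply: ge0_le_integral => //.
  - by move=> w _; rewrite lee_fin.
  - by apply: (measurable_funS measurableT) => //; exact: measurable_nn.
  - by move=> w _; rewrite lee_fin.
rewrite -AE ge0_integral_bigsetU//; last 4 first.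
- exact: index_enum_uniq.
- exact: sub_trivIset tA.
- by apply: (measurable_funS measurableT) => //; exact: measurable_nn.
- by move=> w _; rewrite lee_fin.
apply: (@le_trans _ _ (\sum_(k < m.+1) e%:E * P (A k))%E).
  apply: lee_sum => k _.
  have AkE : A k = [set w | (selection k `&` [set p | del p.1 <= r0]) (X k w, other_dists k w)].
    by apply/seteqP; split=> w /= -[a b]; split => //; exact/selectionE.
  rewrite (_ : integral _ _ _ = \int[P]_(w in A k) (f (X k w))%:E)%E; last first.
    by apply: eq_integral => w /set_mem[-> _].
  rewrite AkE; apply: (integral_indep_section_le _ nu) => //.
  - exact: measurable_other_dists.
  - exact: lawX.
  - exact: indep_other_dists.
  - apply: measurableI; first exact: measurable_selection.
    rewrite -[X in measurable X]setTI; apply: measurable_fun_le => //.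
    exact: measurableT_comp.
  (* Each section of the selection event, cut by the ball of radius [r0], is still a lower set. *)
  move=> s; apply: (integral_lowerset_le _ del _ r0) => //.
  - by move=> y [].
  - move=> y y' [/= sel yr] y'y; split=> /=; first exact: selection_lower sel _.
    exact: le_trans yr.
rewrite -ge0_sume_distrr// -(measure_bigsetU_ord P xpredT)//.
rewrite -[leRHS]mule1 lee_wpmul2l ?lee_fin// AE probability_le1//.
exact: measurableC.
Qed.

Lemma measurable_superlevel r : measurable [set y | r < del y].
Proof.
rewrite (_ : [set y | _] = ~` [set y | del y <= r]).
  by apply: measurableC; exact: measurable_sublevel.
by apply/seteqP; split=> y /=; rewrite ltNge => /negP.
Qed.

(** The list is arbitrary because the upper bound uses all samples and the lower bound all but
    one. *)
Lemma probability_all_far r (s : seq 'I_m.+1) : uniq s ->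
  P (\big[setI/setT]_(i <- s) X i @^-1` [set y | r < del y]) =
  ((1 - fine (nu [set y | del y <= r])) ^+ size s)%:E.
Proof.
move=> us.
pose E (i : option 'I_m.+1) :=
  if i is Some i then X i @^-1` [set y | r < del y] else setT.
have uJ : uniq (map Some s) by rewrite map_inj_uniq// => ? ? [].
have := indepXTh (map Some s) E uJ; rewrite !big_map => ->; last first.
  move=> _ /mapP[i _ ->]; exists [set y | r < del y] => //.
  exact: measurable_superlevel.
rewrite (eq_bigr (fun=> (1 - fine (nu [set y | del y <= r]))%:E)); last first.
  move=> i _; rewrite /E lawX; last exact: measurable_superlevel.
  rewrite (_ : [set y | r < del y] = ~` [set y | del y <= r]); last first.
    by apply/seteqP; split=> y /=; rewrite ltNge => /negP.
  rewrite probability_setC; last exact: measurable_sublevel.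
  by rewrite EFinB fineK// fin_num_measure//; exact: measurable_sublevel.
by rewrite prodEFin big_const_seq count_predT iter_mulr_1.
Qed.

(** Only the [m.+1] disjoint events where a single sample falls in the ball are kept; by
    independence, the [m] other samples contribute the power. *)
Lemma nn_integral_ge r :
  ((m.+1%:R * (1 - fine (nu [set y | (del y <= r)%R])) ^+ m)%:E *
    \int[nu]_(y in [set y | (del y <= r)%R]) (f y)%:E <=
   \int[P]_w (f (X (nn_index w) w))%:E)%E.
Proof.
pose ball := [set y | del y <= r].
pose C k : set (m.+1.-tuple R * Z) :=
  \bigcap_(i in [set i | i != k]) [set s | r < tnth s.1 i].
pose B k := X k @^-1` ball `&` other_dists k @^-1` C k.
have mC k : measurable (C k).
  apply: fin_bigcap_measurable => [|i _]; first exact: finite_finset.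
  have mi : measurable_fun setT (fun s : (m.+1.-tuple R * Z)%type => tnth s.1 i).
    apply: (@measurableT_comp _ _ _ _ _ _ (fun t : m.+1.-tuple R => tnth t i)) => //.
    exact: measurable_tnth.
  have := mi measurableT [set` `]r, +oo[] (measurable_itv _); rewrite setTI.
  congr measurable; apply/seteqP; split=> s /=; rewrite in_itv/= andbT//.
have CE k : other_dists k @^-1` C k =
    \big[setI/setT]_(i <- rem k (enum 'I_m.+1)) X i @^-1` [set y | r < del y].
  rewrite -bigcap_seq; apply/seteqP; split=> w /= Cw i.
    rewrite /= mem_rem_uniq ?enum_uniq// !inE => /andP[ik _].
    by have := Cw i ik; rewrite /= tnth_mktuple (negPf ik).
  move=> /= ik; rewrite tnth_mktuple (negPf ik); apply: Cw.
  by rewrite /= mem_rem_uniq ?enum_uniq// !inE ik mem_enum.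
have mB k : measurable (B k).
  apply: measurableI; rewrite -[X in measurable X]setTI.
    by apply: mX => //; exact: measurable_sublevel.
  exact: measurable_other_dists.
(* On [B k] all entries but the [k]-th exceed [r], while a minimal entry is at most [r]. *)
have Bnn k w : B k w -> nn_index w = k.
  move=> [/= Xk Ck]; apply/eqP; apply: contraT => nk.
  have := Ck _ nk; rewrite /= tnth_mktuple (negPf nk).
  have := psi_min [tuple del (X i w) | i < m.+1] (Th w).
  rewrite -/(nn_index w) => /(_ _ k); rewrite !tnth_mktuple => Nk.
  rewrite ltNge (le_trans (Nk _) Xk)// => i.
  by rewrite tnth_mktuple.
have tB : trivIset setT B.
  by move=> i j _ _ [w [/Bnn <- /Bnn <-]].
have mU : measurable (\big[setU/set0]_(k < m.+1) B k).
  by apply: bigsetU_measurable.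
apply: (@le_trans _ _ (\int[P]_(w in \big[setU/set0]_(k < m.+1) B k)
    (f (X (nn_index w) w))%:E)%E); last first.
  apply: ge0_subset_integral => //; first exact: measurable_nn.
  by move=> w _; rewrite lee_fin.
rewrite ge0_integral_bigsetU//; last 4 first.
- exact: index_enum_uniq.
- exact: sub_trivIset tB.
- by apply: (measurable_funS measurableT) => //; exact: measurable_nn.
- by move=> w _; rewrite lee_fin.
rewrite (eq_bigr (fun=> ((1 - fine (nu ball)) ^+ m)%:E *
    \int[nu]_(y in ball) (f y)%:E)%E); last first.
  move=> k _; transitivity (\int[P]_(w in B k) (f (X k w))%:E)%E.
    by apply: eq_integral => w /set_mem/Bnn ->.
  rewrite (integral_indep_setX _ nu)//.
  - rewrite muleC; congr (_ * _)%E.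
    rewrite CE probability_all_far ?rem_uniq ?enum_uniq//.
    by rewrite size_rem ?mem_enum// size_enum_ord.
  - exact: measurable_other_dists.
  - exact: lawX.
  - exact: indep_other_dists.
  - exact: measurable_sublevel.
by rewrite EFinM -muleA mule_natl sumr_const card_ord lexx.
Qed.

End nearest_neighbour.

(** * From bounds at fixed [m] to limits *)

Lemma bernoulli_ineq {R : realType} (p : R) n : 0 <= p <= 1 ->
  1 - n%:R * p <= (1 - p) ^+ n.
Proof.
move=> /andP[p0 p1]; elim: n => [|n ih]; first by rewrite mul0r subr0 expr0.
have : (1 - p) * (1 - n%:R * p) <= (1 - p) ^+ n.+1.
  by rewrite exprS ler_wpM2l// subr_ge0.
apply: le_trans; rewrite -natr1.
have : 0 <= n%:R * p * p by rewrite !mulr_ge0.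
lra.
Qed.

(* E_ stands for the expectations at the nearest neighbour; only the two-sided
   bounds nn_integral_le and nn_integral_ge on them matter here. *)
Section averages.
Import numFieldNormedType.Exports.
Context {R : realType} {dT : measure_display} {T : measurableType dT}.
Variables (nu : probability T R) (del f : T -> R) (K : R) (E_ : nat -> \bar R).
Hypothesis mdel : measurable_fun setT del.
Hypothesis del0 : forall y, 0 <= del y.
Hypothesis mf : measurable_fun setT f.
Hypothesis f0 : forall y, 0 <= f y.
Hypothesis fK : forall y, f y <= K.
Hypothesis f0E : forall y, del y = 0 -> f y = 0.

Let ball (r : R) := [set y | del y <= r].
Hypothesis ball_gt0 : forall r : R, 0 < r -> (0 < nu (ball r))%E.

Let measurable_ball r : measurable (ball r).
Proof. exact: measurable_sublevel. Qed.

Let ballE r : nu (ball r) = (fine (nu (ball r)))%:E.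
Proof. by rewrite fineK// fin_num_measure. Qed.

Let K0 : 0 <= K.
Proof. by rewrite (le_trans (f0 point)). Qed.

(** Half of [e] bounds the averages up to radius [r0]; since that ball has positive mass, the
    geometric term eventually drops below the other half. *)
Lemma average_cvg_nn :
  (forall m (r0 e : R), 0 <= e ->
    (forall r : R, 0 < r -> r <= r0 ->
      (\int[nu]_(y in ball r) (f y)%:E <= e%:E * nu (ball r))%E) ->
    (E_ m <= e%:E + K%:E * ((1 - fine (nu (ball r0))) ^+ m.+1)%:E)%E) ->
  (forall e : R, 0 < e -> exists2 r0 : R, 0 < r0 &
    forall r : R, 0 < r -> r <= r0 ->
      (\int[nu]_(y in ball r) (f y)%:E <= e%:E * nu (ball r))%E) ->
  forall e : R, 0 < e -> \forall m \near \oo, (E_ m <= e%:E)%E.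
Proof.
move=> Ele avg e e0.
have e20 : 0 < e / 2 by rewrite divr_gt0.
have [r0 r00 /(Ele _ _ _ (ltW e20)) {}Ele] := avg _ e20.
set p := fine _ in Ele.
have p0 : 0 < p by rewrite -lte_fin -ballE ball_gt0.
have p1 : p <= 1 by rewrite -lee_fin -ballE probability_le1.
have : (fun n => K * (1 - p) ^+ n) @ \oo --> (K * 0 : R).
  apply: cvgMr; apply: cvg_expr.
  by rewrite ger0_norm ?subr_ge0// gtrBl.
rewrite mulr0 => /cvgrPdist_le /(_ _ e20)[N _ HN].
exists N => // m /= Nm; apply: (le_trans (Ele m)).
rewrite -EFinM -EFinD lee_fin.
have := HN m.+1 (leq_trans Nm (leqnSn m)); rewrite /= sub0r normrN => H.
have := le_trans (ler_norm _) H; lra.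
Qed.

(** Continuity from above along the balls of radius [1 / (n + 1)], whose intersection is the zero
    set of [del]. *)
Let ball_near (c : R) : (nu [set y | (del y = 0)%R] < c%:E)%E ->
  exists2 r0 : R, 0 < r0 & (nu (ball r0) < c%:E)%E.
Proof.
move=> c0; pose F n := ball n.+1%:R^-1.
have capF : \bigcap_n F n = [set y | del y = 0].
  apply/seteqP; split=> y /= Fy; last by move=> n _; rewrite /F/ball/= Fy invr_ge0.
  apply/eqP; rewrite eq_le del0 andbT; apply/ler_addgt0Pr => e e0; rewrite add0r.
  have [n _ /(_ n (leqnn _)) /= nd] := near_infty_natSinv_lt (PosNum e0).
  exact: le_trans (Fy n I) (ltW nd).
have : nu \o F @ \oo --> nu (\bigcap_n F n).
  apply: nonincreasing_cvg_mu.
  - by rewrite (le_lt_trans (probability_le1 nu (measurable_ball _))) ?ltry.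
  - by move=> n; exact: measurable_ball.
  - by apply: bigcap_measurable => // n _; exact: measurable_ball.
  - move=> n q nq; apply/subsetPset => y; rewrite /F /ball/= => Fy.
    by rewrite (le_trans Fy)// lef_pV2 ?posrE// ler_nat.
rewrite capF.
have mO : measurable [set y | del y = 0].
  by rewrite -capF; apply: bigcap_measurable => // n _; exact: measurable_ball.
move: c0; rewrite -(fineK (fin_num_measure nu _ mO)) lte_fin => c0.
move=> /fine_cvg/cvgr_lt/(_ _ c0)[N _ /(_ N (leqnn _)) /= NF].
by exists N.+1%:R^-1; rewrite ?invr_gt0// ballE lte_fin.
Qed.

Lemma nn_cvg_average :
  (forall m (r : R),
    ((m.+1%:R * (1 - fine (nu (ball r))) ^+ m)%:E *
       \int[nu]_(y in ball r) (f y)%:E <= E_ m)%E) ->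
  (forall e : R, 0 < e -> \forall m \near \oo, (E_ m <= e%:E)%E) ->
  forall e : R, 0 < e -> exists2 r0 : R, 0 < r0 &
    forall r : R, 0 < r -> r <= r0 ->
      (\int[nu]_(y in ball r) (f y)%:E <= e%:E * nu (ball r))%E.
Proof.
move=> geE E0 e e0; set O := [set y | del y = 0].
have mO : measurable O.
  have := mdel measurableT [set 0] (measurable_set1 _); rewrite setTI.
  by congr measurable; apply/seteqP; split.
have OE : nu O = (fine (nu O))%:E by rewrite fineK// fin_num_measure.
set p0 := fine (nu O) in OE.
have p0_ge0 : 0 <= p0 by rewrite fine_ge0.
have [p0_0|p0_neq0] := eqVneq p0 0.
  (* The quarter compensates the factor [(4 * p)^-1] obtained in [coef]. *)
  have e40 : 0 < e / 4 by rewrite divr_gt0.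
  have [N _ HN] := E0 _ e40.
  (* A mass [p] below this threshold gives [N + 1 < 1 / (2 p) < m + 1], hence [N <= m]. *)
  have c0 : (nu O < ((2 * N.+1%:R)^-1 : R)%:E)%E.
    by rewrite OE p0_0 lte_fin invr_gt0 mulr_gt0.
  have [r0 r00 r0c] := ball_near _ c0.
  exists r0 => // r r_gt0 rr0.
  have rc : (nu (ball r) < ((2 * N.+1%:R)^-1 : R)%:E)%E.
    apply: le_lt_trans r0c; apply: le_measure; rewrite ?inE//.
    by move=> y /= /le_trans; apply.
  pose p := fine (nu (ball r)).
  have pE : nu (ball r) = p%:E by rewrite ballE.
  have p_gt0 : 0 < p by rewrite -lte_fin -pE ball_gt0.
  have pc : p < (2 * N.+1%:R)^-1 by rewrite -lte_fin -pE.
  rewrite pE.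
  set L := (\int[nu]_(y in _) _)%E.
  have L0 : (0 <= L)%E by apply: integral_ge0 => y _; rewrite lee_fin.
  pose m := Num.truncn (2 * p)^-1.
  have p2 : 0 < 2 * p by rewrite mulr_gt0.
  have /andP[m1 m2] : m%:R <= (2 * p)^-1 < m.+1%:R.
    by apply: truncn_itv; rewrite invr_ge0 ltW.
  have Nm : (N <= m)%N.
    rewrite -ltnS; apply: ltnW; rewrite -(ltr_nat R); apply: lt_trans m2.
    rewrite -[ltLHS]invrK ltf_pV2 ?posrE ?invr_gt0//.
    by move: pc; rewrite invfM -(ltr_pM2l (ltr0Sn R 1)) mulrA divff ?mul1r.
  have p1 : p <= 1.
    by rewrite -lee_fin -pE probability_le1.
  have mp : m%:R * p <= 1 / 2.
    apply: le_trans (ler_wpM2r (ltW p_gt0) m1) _.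
    by rewrite invfM -mulrA mulVf ?gt_eqF// mulr1 mul1r.
  (* Here [m + 1] exceeds [1 / (2 p)], and Bernoulli gives [(1 - p)^m >= 1 - m p >= 1 / 2]. *)
  have coef : (4 * p)^-1 <= m.+1%:R * (1 - p) ^+ m.
    have b := bernoulli_ineq p m; rewrite p1 (ltW p_gt0) in b.
    apply: (@le_trans _ _ ((2 * p)^-1 * (1 / 2))).
      by rewrite le_eqVlt; apply/orP; left; apply/eqP; field; exact: lt0r_neq0.
    apply: ler_pM => //; [by rewrite invr_ge0 ltW|by rewrite ltW|].
    by have := b isT; lra.
  have p4 : 0 < 4 * p by rewrite mulr_gt0.
  have Le : ((4 * p)^-1%:E * L <= (e / 4)%:E)%E.
    apply: le_trans (HN m Nm); apply: le_trans (geE m r).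
    by rewrite lee_wpmul2r// lee_fin.
  have := lee_wpmul2l _ Le; move=> /(_ (4 * p)%:E); rewrite lee_fin => /(_ (ltW p4)).
  rewrite muleA -EFinM divff ?gt_eqF// mul1e -!EFinM => /le_trans; apply.
  by rewrite lee_fin; lra.
have {}p0_gt0 : 0 < p0 by rewrite lt_neqAle eq_sym p0_neq0.
have K1 : 0 < K + 1 by rewrite ltr_wpDl.
(* As [f] vanishes on [O], the integral is at most [K] times the mass of the ball outside [O]. This
   slack keeps that below [e * p0]; [K + 1] avoids dividing by zero. *)
have c0 : (nu O < (p0 + e * p0 / (K + 1))%:E)%E.
  by rewrite OE lte_fin ltrDl divr_gt0// mulr_gt0.
have [r0 r00 r0c] := ball_near _ c0.
exists r0 => // r r_gt0 rr0.
have rc : (nu (ball r) < (p0 + e * p0 / (K + 1))%:E)%E.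
  apply: le_lt_trans r0c; apply: le_measure; rewrite ?inE//.
  by move=> y /= /le_trans; apply.
have OB : O `<=` ball r by move=> y /= Oy; rewrite /ball/= Oy ltW.
have mBO : measurable (ball r `\` O) by exact: measurableD.
have -> : (\int[nu]_(y in ball r) (f y)%:E =
           \int[nu]_(y in ball r `\` O) (f y)%:E)%E.
  rewrite -{1}(setDUK OB) ge0_integral_setU//; last 3 first.
  - by apply/measurable_EFinP; apply: (measurable_funS measurableT).
  - by move=> y _; rewrite lee_fin.
  - by rewrite disj_set2E setDIK.
  by rewrite integral0_eq ?add0e// => y /= Oy; rewrite f0E.
apply: (@le_trans _ _ (K%:E * nu (ball r `\` O))%E).
  rewrite -integral_cst//; apply: ge0_le_integral => //.
  - by move=> y _; rewrite lee_fin.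
  - by apply/measurable_EFinP; apply: (measurable_funS measurableT).
  - by move=> y _; rewrite lee_fin.
have -> : nu (ball r `\` O) = (nu (ball r) - nu O)%E.
  rewrite measureD//; first by rewrite setIidr.
  by rewrite (le_lt_trans (probability_le1 nu (measurable_ball _))) ?ltry.
have p0p : (nu O <= nu (ball r))%E by apply: le_measure; rewrite ?inE.
move: rc p0p; rewrite ballE OE; set p := fine (nu (ball r)).
rewrite lte_fin lee_fin -EFinB -!EFinM lee_fin => rc p0p.
apply: (@le_trans _ _ (e * p0)); last by rewrite ler_wpM2l// ltW.
apply: (@le_trans _ _ (K * (e * p0 / (K + 1)))).
  by rewrite ler_wpM2l//; lra.
rewrite mulrCA ger_pMr ?mulr_gt0// ler_pdivrMr// mul1r; lra.
Qed.

End averages.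

(** * Transfer to the metric measure setting *)

(** Events are carried along [g] by intersecting over fibres: injectivity leaves at most one index
    in each, and an empty fibre gives [setT]. *)
Lemma mutually_independent_comp {R : realType} {d} {Omega : measurableType d}
    {I I' : eqType} (P : probability Omega R) (F : I' -> set (set Omega))
    (g : I -> I') :
  injective g -> mutually_independent P F -> mutually_independent P (F \o g).
Proof.
move=> ginj indF J E uJ FE.
pose E' j := \bigcap_(i in [set i | g i = j]) E i.
have E'g i : E' (g i) = E i.
  apply/seteqP; split=> [w /(_ i erefl)//|w Ew j /= /ginj ->//].
transitivity (P (\big[setI/setT]_(j <- map g J) E' j)).
  by rewrite big_map; congr (P _); apply: eq_bigr => i _; rewrite E'g.
rewrite indF ?map_inj_uniq//; last first.
  by move=> _ /mapP[i iJ ->]; rewrite E'g; exact: FE.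
by rewrite big_map; apply: eq_bigr => i _; rewrite E'g.
Qed.

Lemma measurable_fun_dist {R : realType} {dT} {T : measurableType dT}
    (dist : T -> T -> R) (x : T) :
  is_metric dist -> @measurable _ T = <<s dist_open dist >> ->
  measurable_fun setT (dist x).
Proof.
move=> [_ [_ [_ tri]]] borel; apply: (measurability _ (RGenInftyO.measurableE R)).
move=> _ [_ [r ->] <-]; rewrite setTI borel; apply: sub_sigma_algebra.
move=> y /=; rewrite in_itv/= => yr; exists (r - dist x y); first by rewrite subr_gt0.
move=> z /= yz; rewrite in_itv/=.
by apply: le_lt_trans (tri x y z) _; rewrite addrC -ltrBrDr.
Qed.

Section lebesgue_point_average.
Context {R : realType} {dT : measure_display} {T : measurableType dT}.
Variables (dist : T -> T -> R) (mu : {measure set T -> \bar R}) (eta : T -> R).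
Variables (x : T) (rad : R) (nu : probability T R) (f : T -> R).
Hypothesis mdist : measurable_fun setT (dist x).
Hypothesis meta : measurable_fun setT eta.
Hypothesis mu_gt0 : forall r : R, 0 < r -> (0 < mu (cball dist x r))%E.
Hypothesis rad0 : 0 < rad.
Hypothesis mu_fin : (mu (cball dist x rad) < +oo)%E.
Hypothesis nuE : forall A, measurable A ->
  nu A = (mu (A `&` cball dist x rad) / mu (cball dist x rad))%E.
Hypothesis fE : forall y, dist x y <= rad -> f y = `|eta y - eta x|.

Let measurable_cball r : measurable (cball dist x r).
Proof. exact: measurable_sublevel. Qed.

Let subset_cball r : r <= rad -> cball dist x r `<=` cball dist x rad.
Proof. by move=> rr y /= /le_trans; exact. Qed.

(** Inside the ball of radius [rad], [nu] is [mu] times a constant, which cancels between the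
    integral and the mass. *)
Lemma average_leE (r e : R) : 0 < r -> r <= rad ->
  (\int[nu]_(y in cball dist x r) (f y)%:E <= e%:E * nu (cball dist x r))%E =
  ((\int[mu]_(y in cball dist x r) (`|eta y - eta x|)%:E) /
    mu (cball dist x r) <= e%:E)%E.
Proof.
move=> r0 rrad; set B := cball dist x r; set B' := cball dist x rad.
have BB' : B `<=` B' by exact: subset_cball.
have muB : (mu B <= mu B')%E by apply: le_measure; rewrite ?inE//; exact: measurable_cball.
have finB' : mu B' \is a fin_num by rewrite ge0_fin_numE.
have finB : mu B \is a fin_num by rewrite ge0_fin_numE// (le_lt_trans muB).
have := mu_gt0 _ r0; have := mu_gt0 _ rad0; rewrite -/B -/B'.
have nuA A : measurable A -> A `<=` B -> nu A = (mu A / mu B')%E.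
  by move=> mA AB; rewrite nuE// setIidl//; exact: subset_trans BB'.
rewrite nuA//; last exact: measurable_cball.
rewrite -(fineK finB') -(fineK finB) !lte_fin.
set c := fine (mu B'); set b := fine (mu B) => c0 b0.
rewrite !inver !gt_eqF//.
have ci0 : 0 <= c^-1 by rewrite invr_ge0 ltW.
have -> : (\int[nu]_(y in B) (f y)%:E = c^-1%:E *
    \int[mu]_(y in B) (`|eta y - eta x|)%:E)%E.
  rewrite -(ge0_integral_mscale mu _ (NngNum ci0))//; last 2 first.
  - exact: measurable_cball.
  - apply/measurable_EFinP; apply: (measurable_funS measurableT) => //.
    by apply: measurableT_comp => //; exact: measurable_funB.
  (* For an integral over [B], the measures need only agree on measurable subsets of [B]. *)
  rewrite (eq_measure_integral (mscale (NngNum ci0) mu)).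
    by apply: eq_integral => y /set_mem By; rewrite fE//; exact: BB'.
  move=> A mA AB; apply: etrans (nuA A mA AB) _; rewrite /= /mscale/= muleC.
  by rewrite -(fineK finB') inver gt_eqF.
rewrite lee_pdivrMr// muleA [X in (_ <= X)%E]muleC lee_pmul2l// lte_fin.
by rewrite invr_gt0.
Qed.

Lemma lebesgue_pointE :
  lebesgue_point dist mu eta x <->
  forall e : R, 0 < e -> exists2 r0 : R, 0 < r0 &
    forall r : R, 0 < r -> r <= r0 ->
    (\int[nu]_(y in cball dist x r) (f y)%:E <= e%:E * nu (cball dist x r))%E.
Proof.
rewrite /lebesgue_point; apply: iff_trans.
  apply: cvge0P => r; rewrite mule_ge0 ?inve_ge0//.
  by apply: integral_ge0 => y _; rewrite lee_fin.
split=> H e e0.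
  have [d /= d0 Hd] := H e e0.
  (* Halving turns the strict condition [r < d] into [r <= d / 2]; the cap [rad] is required by
     [average_leE]. *)
  exists (Num.min (d / 2) rad); first by rewrite lt_min rad0 divr_gt0.
  move=> r r0; rewrite le_min => /andP[rd rrad]; rewrite average_leE//.
  apply: Hd => //=; rewrite sub0r normrN gtr0_norm//.
  by rewrite (le_lt_trans rd)// ltr_pdivrMr// ltr_pMr// ltr1n.
have [r0 r00 Hr] := H e e0.
near=> r.
have r_gt0 : 0 < r by near: r; exact: nbhs_right_gt.
have rr0 : r <= r0 by near: r; exact: nbhs_right_le.
have rrad : r <= rad by near: r; exact: nbhs_right_le.
by rewrite -average_leE//; exact: Hr.
Unshelve. all: by end_near. Qed.

End lebesgue_point_average.

(* Indexing conventions: paper index m >= 1 corresponds to our m.+1, i.e.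
   Xs n = X_{n+1}, Th m = Theta_{m+1} (with values in Z m = Z_{m+1}),
   psi m = psi_{m+1} : [0,oo)^{m+1} x Z_{m+1} -> {0,...,m} (= {1,...,m+1} shifted),
   and the random variable X^x_{m+1} is Xs (psi m (..., Th m w)) w.
   Random variable X is encoded by index None, X_{n+1} by Some (inl n),
   Theta_{m+1} by Some (inr m). *)
Theorem mainTheorem13
  (R : realType) (dT : measure_display) (T : measurableType dT)
  (dist : T -> T -> R) (eta : T -> R) (mu : {measure set T -> \bar R})
  (x : T) (rad : R)
  (dO : measure_display) (Omega : measurableType dO) (P : probability Omega R)
  (dZ : nat -> measure_display) (Z : forall m, measurableType (dZ m))
  (nuZ : forall m, probability (Z m) R)
  (X0 : Omega -> T) (Xs : nat -> Omega -> T) (Th : forall m, Omega -> Z m)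
  (psi : forall m, (m.+1.-tuple R * Z m)%type -> 'I_m.+1) :
  is_metric dist ->
  @measurable _ T = <<s dist_open dist >> ->
  measurable_fun setT eta ->
  (forall r : R, 0 < r -> (0 < mu (cball dist x r))%E) ->
  0 < rad ->
  (mu (cball dist x rad) < +oo)%E ->
  (* laws: X, X_1, X_2, ... have law nu, Theta_m has law nu_m *)
  measurable_fun setT X0 ->
  (forall n, measurable_fun setT (Xs n)) ->
  (forall m, measurable_fun setT (Th m)) ->
  (forall A, measurable A ->
     P (X0 @^-1` A) = (mu (A `&` cball dist x rad) / mu (cball dist x rad))%E) ->
  (forall n A, measurable A ->
     P (Xs n @^-1` A) = (mu (A `&` cball dist x rad) / mu (cball dist x rad))%E) ->
  (forall m (A : set (Z m)), measurable A -> P (Th m @^-1` A) = nuZ m A) ->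
  (* X, X_1, X_2, ..., Theta_1, Theta_2, ... are mutually independent *)
  mutually_independent P (fun i : option (nat + nat) =>
     match i with
     | None => rv_events X0
     | Some (inl n) => rv_events (Xs n)
     | Some (inr m) => rv_events (Th m)
     end) ->
  (* psi_m measurable on [0,oo)^m x Z_m and selects an argmin *)
  (forall m (k : 'I_m.+1),
     measurable ([set p : (m.+1.-tuple R * Z m)%type | forall i, 0 <= tnth p.1 i]
                 `&` (psi m @^-1` [set k]))) ->
  (forall m (r : m.+1.-tuple R) (z : Z m), (forall i, 0 <= tnth r i) ->
     forall k, tnth r (psi m (r, z)) <= tnth r k) ->
  (* eta is bounded on the closed ball of radius rad *)
  (exists M : R, forall y, dist x y <= rad -> `|eta y| <= M) ->
  (lebesgue_point dist mu eta x <->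
   ((fun m : nat =>
       (\int[P]_w (`| eta (Xs (psi m ([tuple dist x (Xs k w) | k < m.+1], Th m w)) w)
                    - eta x |)%:E)%E)
    @ \oo --> (0 : \bar R))).
Proof.
move=> metric borel meta mu_gt0 rad0 mu_fin _ mX mTh _ lawX _ indep mpsi psi_min.
move=> [M etaM].
have [dist_ge0 [dist0 _]] := metric.
have mdist := measurable_fun_dist dist x metric borel.
have distxx : dist x x = 0 by apply/dist0.
have etax : `|eta x| <= M by apply: etaM; rewrite distxx ltW.
pose h y := `|eta y - eta x|.
(* The bound on [eta] holds only on the ball of radius [rad]; truncating at [M + M] bounds [f]
   everywhere and leaves it equal to [h] there. *)
pose f y := Num.min (h y) (M + M).
have mh : measurable_fun setT h.
  by apply: measurableT_comp => //; exact: measurable_funB.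
have mf : measurable_fun setT f by exact: measurable_minr.
have h0 y : 0 <= h y by exact: normr_ge0.
have f0 y : 0 <= f y.
  by rewrite le_min h0 addr_ge0// (le_trans _ etax).
have fM y : f y <= M + M by rewrite ge_min lexx orbT.
have fE y : dist x y <= rad -> f y = h y.
  move=> yrad; apply/min_idPl; rewrite /h (le_trans (ler_normB _ _))// lerD//.
  exact: etaM.
have f0E y : dist x y = 0 -> f y = 0.
  by move=> xy; rewrite fE ?xy ?ltW// /h; move/dist0 : xy => <-; rewrite subrr normr0.
(* The normalised restriction of [mu] is obtained as a probability by taking the law of the first
   sample. *)
pose X0' : {mfun Omega >-> T} := HB.pack (Xs 0%N) (isMeasurableFun.Build _ _ _ _ _ (mX 0%N)).
pose nu : probability T R := distribution P X0'.
have nuE A : measurable A ->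
    nu A = (mu (A `&` cball dist x rad) / mu (cball dist x rad))%E.
  by move=> mA; rewrite -(lawX 0%N).
have lawX' n A : measurable A -> P (Xs n @^-1` A) = nu A.
  by move=> mA; rewrite nuE// lawX.
have nu_gt0 r : 0 < r -> (0 < nu [set y | (dist x y <= r)%R])%E.
  move=> r0; rewrite nuE; last exact: measurable_sublevel.
  rewrite (_ : _ `&` _ = cball dist x (Num.min r rad)); last first.
    by apply/seteqP; split=> y; rewrite /cball/= le_min => /andP.
  have finB : mu (cball dist x rad) \is a fin_num by rewrite ge0_fin_numE.
  have := mu_gt0 _ rad0; rewrite -(fineK finB) lte_fin => c0.
  rewrite inver gt_eqF// mule_gt0 ?lte_fin ?invr_gt0//.
  by apply: mu_gt0; rewrite lt_min r0.
pose X m (i : 'I_m.+1) := Xs i.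
have indep' m : mutually_independent P (fun i : option 'I_m.+1 =>
    if i is Some i then rv_events (X m i) else rv_events (Th m)).
  (* [None] stands for [Th m] here, but for [X0] in the given family. *)
  pose g (i : option 'I_m.+1) : option (nat + nat) :=
    if i is Some i then Some (inl (val i)) else Some (inr m).
  have ginj : injective g by move=> [i|] [j|]//= [/val_inj ->].
  have := mutually_independent_comp P _ g ginj indep.
  by congr mutually_independent; apply/funext => -[].
pose N m w := nn_index m (X m) (Th m) (psi m) (dist x) w.
pose E_ m := (\int[P]_w (f (X m (N m w) w))%:E)%E.
have EE m : E_ m = (\int[P]_w (h (X m (N m w) w))%:E)%E.
  apply: ge0_ae_eq_integral => //.
  - by apply: measurable_nn => // i; exact: mX.
  - by apply: measurable_nn => // i; exact: mX.
  - by move=> w _; rewrite lee_fin.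
  - by move=> w _; rewrite lee_fin.
  (* Almost surely all samples lie in the ball at once, which covers the random index. *)
  have : {ae P, forall w n, dist x (Xs n w) <= rad}.
    apply: ae_foralln => n; exists (Xs n @^-1` ~` cball dist x rad); split.
    - rewrite -[X in measurable X]setTI; apply: (mX n) => //.
      by apply: measurableC; exact: measurable_sublevel.
    - apply: etrans (lawX n _ _) _.
        by apply: measurableC; exact: measurable_sublevel.
      by rewrite setICl measure0 mul0e.
    - by [].
  by apply: filterS => w wrad _; congr EFin; exact: (fE _ (wrad _)).
have E_le m (r0 e : R) : 0 <= e ->
    (forall r : R, 0 < r -> r <= r0 ->
      (\int[nu]_(y in cball dist x r) (f y)%:E <= e%:E * nu (cball dist x r))%E) ->
    (E_ m <= e%:E + (M + M)%:E *
       ((1 - fine (nu (cball dist x r0))) ^+ m.+1)%:E)%E.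
  move=> e0 fe.
  apply: le_trans (nn_integral_le P nu m (X m) (Th m) (psi m) (dist x) f
    (fun i => mX i) (mTh m) (fun i => lawX' i) (indep' m) (mpsi m) (psi_min m)
    mdist (dist_ge0 x) mf f0 r0 e (M + M) e0 fM f0E fe) _.
  have far := probability_all_far P nu m (X m) (Th m) (dist x) (fun i => lawX' i)
    (indep' m) mdist r0 (enum 'I_m.+1) (enum_uniq _).
  rewrite size_enum_ord in far.
  apply: leeD2l; rewrite le_eqVlt; apply/orP; left; apply/eqP; congr (_ * _)%E.
  apply: etrans far; congr (P _); rewrite -bigcap_seq.
  suff -> : [set` enum 'I_m.+1] = setT by [].
  by apply/seteqP; split=> [i _ //|i _ /=]; rewrite mem_enum.
have E_ge m (r : R) :
    ((m.+1%:R * (1 - fine (nu (cball dist x r))) ^+ m)%:E *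
       \int[nu]_(y in cball dist x r) (f y)%:E <= E_ m)%E.
  exact: (nn_integral_ge P nu m (X m) (Th m) (psi m) (dist x) f
    (fun i => mX i) (mTh m) (fun i => lawX' i) (indep' m) (mpsi m) (psi_min m)
    mdist (dist_ge0 x) mf f0 r).
apply: iff_trans; first exact: (lebesgue_pointE dist mu eta x rad nu f).
apply: iff_sym; apply: iff_trans.
  apply: cvge0P => m; apply: integral_ge0 => w _; rewrite lee_fin//.
split=> [E0|avg].
  apply: (nn_cvg_average nu (dist x) f (M + M) E_) => // e e0.
  have [n _ Hn] := E0 e e0; exists n => // k nk; rewrite EE; exact: Hn.
move=> e e0.
have [n _ Hn] := average_cvg_nn nu (dist x) f (M + M) E_ mdist nu_gt0 E_le avg e e0.
by exists n => // k nk; have := Hn k nk; rewrite EE.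
Qed.
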